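(* For integers $n\ge1$, $s\ge0$, and $0\le r\le 2n$, let $a(n,s,r)$ be the number of binary sequences $(b_1,\dots,b_{(s+2)n+1})$ of length $(s+2)n+1$ such that (i) for every $j\ge1$, if the pattern $10$ occurs at least $j$ times (as consecutive entries $b_i=1,b_{i+1}=0$), then the $j$th such occurrence has its starting index $i\ge (s+2)j+1$; and (ii) the total number of indices $i$ with $b_i\ne b_{i+1}$ (occurrences of $10$ or $01$) is at most $r$. Then \[ a(n,s,r) = 2\binom{(s+2)n-1}{r} - (s-2)\sum_{i=0}^{r-1}\binom{(s+2)n-1}{i}. \]
   Context: Positions in a binary sequence are indexed starting from $1$. Occurrences of $10$ are counted in order of their starting positions. *)

(* Defs.v *)
From HB Require Import structures.
From mathcomp Require Import all_boot all_order all_algebra.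
Set Implicit Arguments. Unset Strict Implicit. Unset Printing Implicit Defensive.

(* Binary sequences are represented as seq bool; the paper's b_i (1-indexed)
   is [nth false b (i-1)]. *)

Definition bit (b : seq bool) (i : nat) : bool := nth false b i.-1.

Definition occ10 (b : seq bool) : seq nat :=
  [seq i <- iota 1 (size b).-1 | bit b i && ~~ bit b i.+1].

Definition nchanges (b : seq bool) : nat :=
  count (fun i => bit b i != bit b i.+1) (iota 1 (size b).-1).

Definition cond_i (s : nat) (b : seq bool) : bool :=
  all (fun j => (s + 2) * j + 1 <= nth 0 (occ10 b) j.-1)
      (iota 1 (size (occ10 b))).

Definition cond_ii (r : nat) (b : seq bool) : bool := nchanges b <= r.

Definition a_count (n s r : nat) : nat :=
  #|[pred t : ((s + 2) * n + 1).-tuple bool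
      | cond_i s (tval t) && cond_ii r (tval t)]|.

(* Main.v *)
(* Encode b by its first bit x and the word d of its (s+2)n successive differences. Since occurrences of
   10 and 01 alternate, condition (i) says that the walk W_j = 2j - #(changes among the first (s+2)j)
   satisfies W_j >= 1 + x for 1 <= j <= n. Hence, for a fixed d with q changes, the number of
   admissible x is the amount (0, 1 or 2) by which the minimum of the future of the periodically
   extended walk rises between times 0 and 1. Summed over the n rotations of d by multiples of s+2,
   these rises telescope to W_n = 2n - q (a cycle lemma for up-steps of size at most 2), so exactly
   (2n - q)/n * C((s+2)n, q) sequences have q changes; summing over q <= r gives the formula. *)
Require Import Defs.
From HB Require Import structures.
From mathcomp Require Import all_boot all_order all_algebra.
From mathcomp Require Import zify.
Import GRing.Theory Num.Theory.
Local Open Scope ring_scope.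

Fixpoint prefix_min (f : nat -> int) (m : nat) : int :=
  if m is m'.+1 then Num.min (f m) (prefix_min f m') else f 0%N.

Lemma le_prefix_min (f : nat -> int) m (h : int) :
  reflect (forall j, (j <= m)%N -> h <= f j) (h <= prefix_min f m).
Proof.
elim: m => [|m IH] /=.
  by apply: (iffP idP) => [hf j|]; [rewrite leqn0 => /eqP-> | exact].
rewrite Order.TotalTheory.le_min; apply: (iffP andP).
  move=> [h1 /IH h2] j; rewrite leq_eqVlt => /predU1P[->//|]; exact: h2.
by move=> hf; split; [exact: hf | apply/IH => j jm; apply: hf; exact: leqW].
Qed.

Lemma prefix_min_le (f : nat -> int) m j : (j <= m)%N -> prefix_min f m <= f j.
Proof. by move: j; apply/le_prefix_min. Qed.

(* The i-th summand is M (i+1) - M i, where M i is the minimum of f over all times >= i;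
   by periodicity the window [i, i + n] suffices to compute it. *)
Lemma sum_records (f : nat -> int) (n : nat) (w : int) :
  0 <= w ->
  (forall i, (i <= n)%N -> f (i + n)%N = f i + w) ->
  (forall i, (i < n)%N -> f i.+1 <= f i + 2) ->
  \sum_(0 <= i < n)
    ((all (fun j => f i + 1 <= f (i + j)%N) (iota 1 n))%:Z +
     (all (fun j => f i + 2 <= f (i + j)%N) (iota 1 n))%:Z) = w.
Proof.
move=> w0 fper fstep.
pose M i := prefix_min (fun j => f (i + j)%N) n.
have M_shift : M n = M 0%N + w.
  apply: Order.POrderTheory.le_anti; apply/andP; split.
    rewrite -lerBlDr; apply/le_prefix_min => j jn.
    by rewrite lerBlDr add0n -fper // addnC; apply: (@prefix_min_le (fun j => f (n + j)%N)).
  apply/le_prefix_min => j jn; rewrite addnC fper // lerD2r.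
  exact: (@prefix_min_le (fun j => f (0 + j)%N)).
(* The window of [M i.+1] has one extra point, [i.+1 + n], where [f] is at least [f i.+1] because
   [0 <= w]. *)
have allE i h : (0 < n)%N -> (i < n)%N -> all (fun j => f i + h <= f (i + j)%N) (iota 1 n)
    = (f i + h <= M i.+1).
  move=> n0 ltin; apply/allP/le_prefix_min => H j.
    rewrite leq_eqVlt => /predU1P[->|jn].
      rewrite fper //; apply: (@Order.POrderTheory.le_trans _ _ (f (i + 1)%N)).
        by apply: H; rewrite mem_iota; lia.
      by rewrite addn1; lia.
    by rewrite addSnnS; apply: H; rewrite mem_iota; lia.
  rewrite mem_iota => /andP[j0 jn].
  by have := H j.-1; rewrite addSnnS prednK //; apply; lia.
rewrite (eq_big_nat _ _ (F2 := fun i => M i.+1 - M i)); last first.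
  move=> i /andP[_ ltin]; have n0 : (0 < n)%N by lia.
  rewrite !allE //.
  have le1 : M i.+1 <= f i + 2.
    apply: (@Order.POrderTheory.le_trans _ _ (f i.+1)); last exact: fstep.
    by have := @prefix_min_le (fun j => f (i.+1 + j)%N) n 0 isT; rewrite addn0.
  (* f (i+1) <= f i + 2 caps the rise M (i+1) - M i at 2. *)
  have -> : M i = Num.min (f i) (M i.+1); last by lia.
  apply: Order.POrderTheory.le_anti; apply/andP; split.
    rewrite Order.TotalTheory.le_min; apply/andP; split.
      by have := @prefix_min_le (fun j => f (i + j)%N) n 0 isT; rewrite addn0.
    apply/le_prefix_min => j; rewrite leq_eqVlt => /predU1P[->|jn].
      rewrite fper //; have := @prefix_min_le (fun j => f (i + j)%N) n 1 n0.
      by rewrite /M addn1; lia.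
    by rewrite addSnnS; apply: (@prefix_min_le (fun j => f (i + j)%N)).
  apply/le_prefix_min => -[|j] jn; rewrite Order.TotalTheory.ge_min.
    by rewrite addn0 Order.POrderTheory.lexx.
  rewrite -addSnnS (@prefix_min_le (fun j => f (i.+1 + j)%N)) ?orbT //.
  exact: ltnW.
by rewrite telescope_sumr // M_shift addrC addKr.
Qed.

(** The walk condition W_j >= [h] written without subtraction; [h] will be 1 plus the first bit. *)
Definition stays_below (k n h : nat) (d : seq bool) : bool :=
  all (fun j => count id (take (k * j) d) + h <= 2 * j)%N (iota 1 n).

Lemma take_rot_cat (T : Type) (a b : nat) (d : seq T) :
  (a <= size d)%N -> (b <= size d)%N -> take b (rot a d) = take b (drop a (d ++ d)).
Proof.
move=> ad bd; rewrite /rot drop_cat ltn_neqAle ad andbT.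
case: eqP => [->|/eqP ne] /=; first by rewrite drop_size subnn drop0 take_size.
rewrite !take_cat size_drop; case: ltnP => // h; congr (_ ++ _).
by rewrite take_takel //; lia.
Qed.

(* Reading d ++ d stands in for the periodic extension of d. *)
Lemma sum_rot_stays_below (k n : nat) (d : seq bool) :
  size d = (k * n)%N -> (count id d <= 2 * n)%N ->
  (\sum_(0 <= i < n) (stays_below k n 1 (rot (k * i) d) + stays_below k n 2 (rot (k * i) d))
   = 2 * n - count id d)%N.
Proof.
move=> sd cd.
pose c i := count id (take (k * i) (d ++ d)).
(* [f] is the extended walk: it climbs at most 2 per step since [c] never decreases, and gains
   [2 * n - count id d] per period. *)
pose f i : int := (2 * i)%:Z - (c i)%:Z.
have c_mono i : (c i <= c i.+1)%N.
  by rewrite /c mulnS addnC takeD count_cat leq_addr.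
have c_per i : (i <= n)%N -> (c (i + n) = c i + count id d)%N.
  move=> lein; rewrite /c mulnDr addnC takeD count_cat -sd take_size_cat //.
  by rewrite drop_size_cat // takel_cat 1?addnC // sd leq_mul2l lein orbT.
have c_rot i j : (i <= n)%N -> (j <= n)%N ->
    (c (i + j) = c i + count id (take (k * j) (rot (k * i) d)))%N.
  move=> lein lejn; rewrite /c mulnDr takeD count_cat take_rot_cat //;
  by rewrite sd leq_mul2l ?lein ?lejn orbT.
have stayE i h : (i < n)%N -> stays_below k n h (rot (k * i) d)
    = all (fun j => f i + h%:Z <= f (i + j)%N) (iota 1 n).
  move=> ltin; apply: eq_in_all => j; rewrite mem_iota => /andP[_ jn].
  by rewrite /f (c_rot i j) ?(ltnW ltin) //; lia.
apply: (can_inj absz_nat); rewrite (big_morph Posz PoszD (erefl _)).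
have <- // := @sum_records f n (2 * n - count id d)%N%:Z; first last.
- by move=> i _; rewrite /f; have := c_mono i; lia.
- by move=> i lein; rewrite /f c_per //; lia.
by apply: eq_big_nat => i /andP[_ ltin]; rewrite !stayE // PoszD.
Qed.

(** A word is the indicator of the set of its [true] positions, so these words correspond to the
    [q]-subsets of ['I_L]. *)
Lemma card_tuple_count_id (L q : nat) :
  (\sum_(d : L.-tuple bool | count id d == q) 1 = 'C(L, q))%N.
Proof.
rewrite -[in RHS](card_ord L) -card_draws -sum1_card.
pose h (A : {set 'I_L}) := [tuple i \in A | i < L].
have hK : cancel h (fun d : L.-tuple bool => [set i | tnth d i]).
  by move=> A; apply/setP => i; rewrite inE tnth_mktuple.
have Kh : cancel (fun d : L.-tuple bool => [set i | tnth d i]) h.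
  by move=> d; apply: eq_from_tnth => i; rewrite tnth_mktuple inE.
rewrite (reindex h); last by exists (fun d => [set i | tnth d i]) => x _.
apply: eq_bigl => A; rewrite inE /h /= count_map cardE size_filter enumT.
by congr (_ == _); apply: eq_count.
Qed.

(** Double counting over words and rotations: each rotation permutes the words with [q] changes, so
    all [n] rotations give the same total, while the rotations of a single word contribute
    [2 * n - q]. *)
Lemma sum_stays_below (k n q : nat) : (q <= 2 * n)%N ->
  (n * \sum_(d : (k * n).-tuple bool | count id d == q)
         (stays_below k n 1 d + stays_below k n 2 d)
   = (2 * n - q) * 'C(k * n, q))%N.
Proof.
move=> q2n.
transitivity (\sum_(d : (k * n).-tuple bool | count id d == q) \sum_(0 <= i < n)
   (stays_below k n 1 (rot (k * i) d) + stays_below k n 2 (rot (k * i) d)))%N.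
  rewrite -[X in (X * _)%N = _](subn0 n) -sum_nat_const_nat [RHS]exchange_big /=.
  apply: eq_bigr => i _; rewrite [LHS](reindex_inj (h := fun d : (k * n).-tuple bool => [tuple of rot (k * i) d])) /=.
    apply: eq_big => [d|//]; have /permP-> // : perm_eq (rot (k * i) d) d.
    by rewrite perm_rot.
  by move=> d1 d2 /(congr1 val) /= /rot_inj /val_inj.
rewrite -card_tuple_count_id big_distrr /=; apply: eq_bigr => d /eqP cd.
by rewrite muln1 sum_rot_stays_below ?size_tuple ?cd.
Qed.

Definition differences (b : seq bool) : seq bool :=
  if b is x :: b' then pairmap addb x b' else [::].

Lemma count_changes b m : (m <= (size b).-1)%N ->
  count (fun i => bit b i != bit b i.+1) (iota 1 m) = count id (take m (differences b)).
Proof.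
case: b => [|x b] /=; first by rewrite leqn0 => /eqP->.
move=> mb; rewrite -(map_nth_iota0 false) ?size_pairmap // (iotaDl 1 0) !count_map.
apply: eq_in_count => i; rewrite mem_iota => /andP[_ im] /=.
by rewrite (nth_pairmap false) ?(leq_trans im) // /bit /= -negb_eqb negb_eqb.
Qed.

Lemma nchangesE b : nchanges b = count id (differences b).
Proof.
rewrite /nchanges count_changes // take_oversize //.
by case: b => //= x b; rewrite size_pairmap.
Qed.

(** Ascents minus descents telescope to the last bit minus the first, so the number of changes
    determines the number of descents up to the end bits. *)
Lemma count_descents b m :
  (2 * count (fun i => bit b i && ~~ bit b i.+1) (iota 1 m) + bit b m.+1
   = count (fun i => bit b i != bit b i.+1) (iota 1 m) + bit b 1)%N.
Proof.
elim: m => [|m IH] //; have -> : iota 1 m.+1 = iota 1 m ++ [:: m.+1].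
  by rewrite -{1}(addn1 m) iotaD.
rewrite !count_cat /=.
by move: IH; case: (bit b m.+1); case: (bit b m.+2) => /=; lia.
Qed.

(** Trades the position of an occurrence for a count in a prefix. The rank [j] starts at 0, and its
    bound keeps [nth] off its default value. *)
Lemma nth_filter_iota_gt (p : pred nat) (L m j : nat) : (m <= L)%N ->
  (j < count p (iota 1 L))%N ->
  (m < nth 0 (filter p (iota 1 L)) j)%N = (count p (iota 1 m) <= j)%N.
Proof.
move=> mL; rewrite -{1 2}(subnKC mL) iotaD count_cat filter_cat nth_cat size_filter => jc.
case: (ltnP j (count p _)) => cj.
  have /(mem_nth 0%N) : (j < size (filter p (iota 1 m)))%N by rewrite size_filter.
  by rewrite mem_filter mem_iota => /andP[_] /=; lia.
have /(mem_nth 0%N) : (j - count p (iota 1 m) < size (filter p (iota (1 + m) (L - m))))%N.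
  by rewrite size_filter; lia.
by rewrite mem_filter mem_iota => /andP[_] /=; lia.
Qed.

Lemma cond_iE (s n : nat) (b : seq bool) : (1 <= n)%N ->
  (size b).-1 = ((s + 2) * n)%N ->
  cond_i s b = stays_below (s + 2) n (bit b 1).+1 (differences b).
Proof.
move=> n1 sb; set p := fun i => bit b i && ~~ bit b i.+1.
have le_kn j : (j <= n)%N -> ((s + 2) * j <= (s + 2) * n)%N by rewrite leq_mul2l orbC => ->.
have -> : stays_below (s + 2) n (bit b 1).+1 (differences b)
    = all (fun j => count p (iota 1 ((s + 2) * j)) < j)%N (iota 1 n).
  apply: eq_in_all => j; rewrite mem_iota => /andP[j1 jn].
  rewrite -count_changes; last by rewrite sb le_kn //; lia.
  (* Parity absorbs the unknown end bit e: for D descents, 2D + e <= 2j - 1 exactly when D < j. *)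
  by have := count_descents b ((s + 2) * j); rewrite -/p; case: (bit b _.+1); lia.
rewrite /cond_i /occ10 -/p sb size_filter.
apply/allP/allP => H j; rewrite mem_iota => /andP[j1 jn].
  have lejn : (j <= n)%N by lia.
  (* If there is no [j]th occurrence, the whole sequence, hence every prefix, has fewer than [j]. *)
  case: (leqP j (count p (iota 1 ((s + 2) * n)))) => jc.
    have := H j; rewrite mem_iota addn1 nth_filter_iota_gt ?le_kn //; lia.
  apply: leq_ltn_trans jc.
  by rewrite -(subnKC (le_kn _ lejn)) iotaD count_cat leq_addr.
(* At [n] the prefix covers all starting positions, so there are fewer than [n] occurrences and
   every [j] to be tested lies in the range of [H]. *)
have := H n; rewrite mem_iota => /(_ ltac:(lia)) cn.
have ltjn : (j < n)%N by lia.
rewrite addn1 nth_filter_iota_gt ?le_kn //; [|lia..].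
by have := H j; rewrite mem_iota; lia.
Qed.

(** A sequence is recovered from its first bit and its differences by partial xors ([scanl addb]);
    the two summands are the first bits [false] and [true]. *)
Lemma a_countE (n s r : nat) : (1 <= n)%N ->
  a_count n s r = (\sum_(d : ((s + 2) * n).-tuple bool | count id d <= r)
    (stays_below (s + 2) n 1 d + stays_below (s + 2) n 2 d))%N.
Proof.
move=> n1; set L := ((s + 2) * n)%N.
pose h (xd : bool * L.-tuple bool) : (L + 1).-tuple bool :=
  tcast (esym (addn1 L)) [tuple of xd.1 :: scanl addb xd.1 xd.2].
pose g (b : (L + 1).-tuple bool) : bool * L.-tuple bool :=
  let b' := tcast (addn1 L) b in (thead b', [tuple of pairmap addb (thead b') (behead b')]).
have hK : cancel h g.
  move=> [x d]; rewrite /g /h tcastKV /=; congr (_, _); apply: val_inj => /=.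
  by rewrite scanlK // => y z; rewrite addKb.
have gK : cancel g h.
  move=> b; rewrite /h /g /=; apply: (canLR (tcastK _)); apply: val_inj.
  case/tupleP: (tcast _ b) => x b' /=; rewrite theadE pairmapK // => y z.
  exact: addKb.
have tval_h xd : tval (h xd) = xd.1 :: scanl addb xd.1 xd.2 by rewrite val_tcast.
rewrite /a_count -sum1_card big_mkcond (reindex h) /=; last by exists g => ? _.
transitivity (\sum_(x : bool) \sum_(d : L.-tuple bool)
    (stays_below (s + 2) n x.+1 d && (count id d <= r)))%N.
  rewrite pair_bigA /=; apply: eq_bigr => -[x d] _.
  rewrite !unfold_in /= /cond_ii nchangesE (@cond_iE _ n) ?tval_h //=.
    by rewrite scanlK => [|y z]; [case: (_ && _) | rewrite addKb].
  by rewrite size_scanl size_tuple.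
rewrite big_bool /= addnC -big_split [RHS]big_mkcond /=.
by apply: eq_bigr => d _; case: leqP; rewrite ?andbT ?andbF.
Qed.

Theorem theorem1p3 (n s r : nat) (hn : (1 <= n)%N) (hr : (r <= 2 * n)%N) :
  (a_count n s r)%:Z =
    2 * ('C((s + 2) * n - 1, r))%:Z
    - ((s%:Z) - 2) * \sum_(0 <= i < r) ('C((s + 2) * n - 1, i))%:Z.
Proof.
have [M eM] : exists M, ((s + 2) * n = M.+1)%N by exists ((s + 2) * n).-1; rewrite prednK; lia.
pose B q := (\sum_(d : ((s + 2) * n).-tuple bool | count id d == q)
    (stays_below (s + 2) n 1 d + stays_below (s + 2) n 2 d))%N.
have BE q : (q <= 2 * n)%N -> (n * B q = (2 * n - q) * 'C(M.+1, q))%N.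
  by move=> q2n; rewrite sum_stays_below // eM.
have -> : ((s + 2) * n - 1 = M)%N by rewrite eM subn1.
rewrite a_countE //.
elim: r hr => [|r IH] hr.
  rewrite bin0 big_geq // mulr0 subr0.
  rewrite (eq_bigl (fun d : ((s + 2) * n).-tuple bool => count id d == 0))%N; last first.
    by move=> d; rewrite leqn0.
  rewrite -/(B 0%N); have /eqP := BE 0%N isT.
  by rewrite bin0 subn0 muln1 mulnC eqn_pmul2r // => /eqP->.
rewrite (bigID (fun d : ((s + 2) * n).-tuple bool => count id d == r.+1)) /=.
rewrite (eq_bigl (fun d : ((s + 2) * n).-tuple bool => count id d == r.+1)); last first.
  by move=> d; case: eqP => [->|]; rewrite ?leqnn ?andbF.
rewrite -/(B r.+1) (eq_bigl (fun d : ((s + 2) * n).-tuple bool => count id d <= r)%N); last first.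
  by move=> d; rewrite [LHS]andbC -ltn_neqAle.
rewrite PoszD IH ?(ltnW hr) // big_nat_recr //=.
have := BE r.+1 hr; have := mul_bin_left M r; rewrite binS.
set S := \sum_(_ <= _ < _) _; set x := 'C(M, r.+1); set y := 'C(M, r) => exy eB.
have n0 : n%:Z != 0 by lia.
(* This is the increment of the claimed formula from [r] to [r.+1]. Multiplied by [n], it follows
   from [eB], from [exy], which says (r + 1)x = (M - r)y, and from [eM]. *)
suff : B r.+1 = 2 * x%:Z - s%:Z * y%:Z :> int by lia.
apply: (mulfI n0); nia.
Qed.
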